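(* Let $\Omega\subset\mathbb{C}^n$ be a bounded pseudoconvex domain. For each $\varepsilon>0$ and each $k\in\mathbb{Z}^+$, there do not exist a function $\rho\in PSH^-(\Omega)$ and a constant $C>0$ such that $$-\rho(z)\le C\,\delta_\Omega(z)\,\bigl(L_k(\delta_\Omega(z))\bigr)^{-\varepsilon}\quad\text{for all }z\in\Omega\text{ near }\partial\Omega.$$
   Context: $\delta_\Omega$ is the distance function to $\partial\Omega$. $PSH^-(\Omega)$ is the set of all (strictly) negative plurisubharmonic functions on $\Omega$. For small $x>0$, $L_k(x)$ denotes the $k$-times iterated logarithm $L_1(x)=|\log x|$, $L_{j+1}(x)=\log L_j(x)$, so that $L_k(x)=\log(\log\cdots|\log x|)$ with $\log$ occurring $k$ times in total. ''For all $z$ near $\partial\Omega$'' means for all $z\in\Omega\cap U$ for some neighborhood $U$ of $\partial\Omega$ (small enough that the iterated logarithm is defined and positive there). *)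

(* Defs.v *)
From HB Require Import structures.
From mathcomp Require Import all_boot all_order all_algebra.
From mathcomp Require Import complex.
From mathcomp Require Import all_classical all_reals all_analysis.
Import Order.TTheory GRing.Theory Num.Theory.
Import numFieldNormedType.Exports.

Set Implicit Arguments.
Unset Strict Implicit.
Unset Printing Implicit Defensive.

Local Open Scope classical_set_scope.
Local Open Scope ring_scope.
Local Open Scope complex_scope.

(* Packaging R[i] as a [numClosedFieldType] lets it, and the row vectors over
   it, inherit the topology that MathComp-Analysis puts on numeric fields. *)
Definition Cx (R : realType) : numClosedFieldType := R[i].

Section Defs.
Variable R : realType.

(* The library norm on ['rV_n] is the sup norm (with values in [Cx R]): it gives
   the right topology and bounded sets, but not the Euclidean distance. *)
Definition enorm (n : nat) (z : 'rV[Cx R]_n) : R :=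
  Num.sqrt (\sum_(j < n) (complex.Re (z ord0 j) ^+ 2 +
                          complex.Im (z ord0 j) ^+ 2)).

Definition boundary (X : topologicalType) (A : set X) : set X :=
  closure A `\` interior A.

Definition bdist (n : nat) (Omega : set 'rV[Cx R]_n) (z : 'rV[Cx R]_n) : R :=
  inf [set enorm (z - w) | w in boundary Omega].

(* [f] is only constrained on [D]: the points outside [D] are isolated in
   [subspace D]. *)
Definition usc_on (X : topologicalType) (D : set X) (f : X -> \bar R) : Prop :=
  @lower_semicontinuous (subspace D) R (fun x => - f x)%E.

Definition circle_point (a : Cx R) (r t : R) : Cx R :=
  a + ((r * cos t) +i* (r * sin t) : R[i]).

(* Values in [-oo, +oo[; the function identically -oo is allowed. A usc
   function is bounded above on circles, so the extended integral in the
   sub-mean value inequality is always meaningful. *)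
Definition subharmonic (D : set (Cx R)) (u : Cx R -> \bar R) : Prop :=
  [/\ usc_on D u,
      forall z, D z -> (u z < +oo)%E
    & forall (a : Cx R) (r : R), 0 < r ->
        (forall w : Cx R, ComplexField.Normc.normc (w - a) <= r -> D w) ->
        (u a <= ((2 * pi)^-1)%:E *
          \int[lebesgue_measure]_(t in `[0%R, (2 * pi)%R]%classic)
            u (circle_point a r t))%E].

Definition psh (n : nat) (Omega : set 'rV[Cx R]_n)
    (f : 'rV[Cx R]_n -> \bar R) : Prop :=
  [/\ usc_on Omega f,
      forall z, Omega z -> (f z < +oo)%E
    & forall a b : 'rV[Cx R]_n,
        subharmonic [set zeta : Cx R | Omega (a + zeta *: b)]
                    (fun zeta => f (a + zeta *: b))].

Definition neg_psh (n : nat) (Omega : set 'rV[Cx R]_n)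
    (f : 'rV[Cx R]_n -> \bar R) : Prop :=
  psh Omega f /\ forall z, Omega z -> (f z < 0)%E.

Definition domain (n : nat) (Omega : set 'rV[Cx R]_n) : Prop :=
  [/\ open Omega, connected Omega & Omega !=set0].

(* Existence of a continuous plurisubharmonic exhaustion function, i.e. one
   whose sublevel sets are relatively compact in [Omega]. *)
Definition pseudoconvex (n : nat) (Omega : set 'rV[Cx R]_n) : Prop :=
  exists psi : 'rV[Cx R]_n -> R,
    [/\ {within Omega, continuous psi},
        psh Omega (EFin \o psi)
      & forall c : R,
          compact (closure [set z | Omega z /\ psi z < c]) /\
          closure [set z | Omega z /\ psi z < c] `<=` Omega].

(* [iterlog k] is L_k for k >= 1; [iterlog 0] is a junk value. Since [ln] is 0
   on nonpositive reals, L_k is meaningful at x only when the earlier iterates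
   are positive. *)
Definition iterlog (k : nat) (x : R) : R := iter k.-1 (@ln R) `|ln x|.

Definition iterlog_pos (k : nat) (x : R) : Prop :=
  forall j : nat, (0 < j <= k)%N -> 0 < iterlog j x.

End Defs.

(* Main.v *)
(* Hopf's lemma on a complex disc.  In a complex line through a point z0 of
   Omega, the point z0 + b of the complement closest to z0 is a boundary point,
   and the open disc of center z0 and radius |b| lies in Omega.  On the unit disc,
   (3/2 - |zeta|^2)^2 is strictly subharmonic where |zeta|^2 > 3/4, so the maximum
   principle on an annulus gives -rho(z0 + x b) >= c (1 - x) as x -> 1-, whereas
   delta(z0 + x b) <= (1 - x) |b| and L_k(delta) tends to infinity. *)
Require Import Defs.
From HB Require Import structures.
From mathcomp Require Import all_boot all_order all_algebra.
From mathcomp Require Import complex ring lra.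
From mathcomp Require Import all_classical all_reals all_analysis.
Import Order.TTheory GRing.Theory Num.Theory.
Import numFieldNormedType.Exports.

Local Open Scope classical_set_scope.
Local Open Scope ring_scope.

(** * Semicontinuity, integrals and iterated logarithms *)

(** The sublevel sets of [f] at its own values on [K] are nested, so they generate a proper filter;
    compactness gives it a cluster point, which is a minimizer by semicontinuity. *)
Lemma lsc_compact_min (T : topologicalType) (R : realType) (K : set T)
    (f : T -> \bar R) :
  compact K -> K !=set0 ->
  (forall x (a : R), K x -> (a%:E < f x)%E ->
     \forall y \near x, K y -> (a%:E < f y)%E) ->
  exists2 x, K x & forall y, K y -> (f x <= f y)%E.
Proof.
move=> cK [x0 Kx0] lscf.
pose F := filter_from K (fun y => K `&` [set x | (f x <= f y)%E]).
have FF : ProperFilter F.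
  apply: filter_from_proper; last by move=> y Ky; exists y; split => /=.
  apply: filter_from_filter; first by exists x0.
  move=> i j Ki Kj; case: (leP (f i) (f j)) => ij.
    by exists i => // x [Kx /= xi]; split; split => //=; apply: le_trans ij.
  by exists j => // x [Kx /= xj]; split; split => //=; apply: le_trans (ltW ij).
have [|p [Kp clp]] := cK F FF; first by exists x0 => // x [].
exists p => // y Ky; rewrite leNgt; apply/negP => fyp.
have [a ya ap] : exists2 a : R, (f y <= a%:E)%E & (a%:E < f p)%E.
  move: fyp; case: (f y) => [r||]; case: (f p) => [s||] //.
  - by move=> rs; exists r.
  - by move=> _; exists r => //; exact: ltry.
  - by move=> _; exists (s - 1); rewrite ?leNye// lte_fin ltrBlDr ltrDl.
  - by move=> _; exists 0; rewrite ?leNye// ltry.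
have [z [[Kz /= zy] /(_ Kz)]] : K `&` [set x | (f x <= f y)%E] `&`
    [set z | K z -> (a%:E < f z)%E] !=set0.
  by apply: clp; [exists y | exact: lscf].
by rewrite ltNge (le_trans zy ya).
Qed.

Section LeIntegral.
Import HBNNSimple.

(* The extended integral is a difference of suprema of integrals of simple
   functions, hence monotone even on non-measurable functions. *)
Lemma le_integral_nonmeasurable d (T : measurableType d) (R : realType)
    (mu : {measure set T -> \bar R}) (D : set T) (f g : T -> \bar R) :
  (forall x, D x -> (f x <= g x)%E) ->
  (\int[mu]_(x in D) f x <= \int[mu]_(x in D) g x)%E.
Proof.
move=> fg; have {}fg x : ((f \_ D) x <= (g \_ D) x)%E.
  by rewrite /patch; case: ifPn => //; rewrite inE; exact: fg.
have mono (u v : T -> \bar R) : (forall x, (u x <= v x)%E) ->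
    (ereal_sup [set sintegral mu h | h in [set h : {nnsfun T >-> R} |
       forall x, ((h x)%:E <= u x)%E]] <=
     ereal_sup [set sintegral mu h | h in [set h : {nnsfun T >-> R} |
       forall x, ((h x)%:E <= v x)%E]])%E.
  move=> uv; apply: ge_ereal_sup => _ [h /= hu <-]; apply: ereal_sup_ubound.
  by exists h => //= x; exact: le_trans (hu x) (uv x).
rewrite /integral; apply: leeB; apply: mono => x.
  by apply: (@funepos_le _ _ setT); rewrite ?inE.
by apply: (@funeneg_le _ _ setT); rewrite ?inE.
Qed.

End LeIntegral.

(** Induction on [k]: the bound [M] for one more logarithm is the bound [expR M] for the previous
    iterate, whose positivity also keeps [ln] away from its junk values. *)
Lemma iterlog_gt (R : realType) (k : nat) (M : R) : (0 < k)%N ->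
  exists2 eta : R, 0 < eta & forall x, 0 < x < eta -> M < iterlog k x.
Proof.
case: k => // k _; elim: k M => [|k IH] M.
  exists (expR (- M)) => [|x /andP[x0 xM]]; first exact: expR_gt0.
  rewrite /iterlog /= -normrN; apply: lt_le_trans (ler_norm _).
  by rewrite ltrNr -ltr_expR lnK.
have [eta eta0 Heta] := IH (expR M); exists eta => // x /Heta.
rewrite /iterlog [iter k.+2.-1 _ _]iterS /= => expM.
by rewrite -ltr_expR lnK// posrE (lt_trans (expR_gt0 _) expM).
Qed.

Lemma integral_circle (R : realType) (c e q b g : R) :
  (\int[lebesgue_measure]_(t in `[0%R, (2 * pi)%R]%classic)
     (c - e * (q - (b * cos t + g * sin t)) ^+ 2)%:E =
   (2 * pi * (c - e * (q ^+ 2 + (b ^+ 2 + g ^+ 2) / 2)))%:E)%E.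
Proof.
pose F (t : R) : R := (c - e * q ^+ 2) * t + 2 * e * q * (b * sin t - g * cos t)
  - e * (b ^+ 2 * (t + sin t * cos t) / 2 + b * g * (sin t) ^+ 2 +
         g ^+ 2 * (t - sin t * cos t) / 2).
have dF (t : R) : is_derive t 1 F (c - e * (q - (b * cos t + g * sin t)) ^+ 2).
  rewrite /F; apply: is_derive_eq.
  rewrite /GRing.scale /=; apply/eqP; rewrite -subr_eq0; apply/eqP.
  (* [F] uses (t + sin t cos t) / 2 and (t - sin t cos t) / 2 as primitives of cos^2 and sin^2,
     which is correct only modulo cos^2 + sin^2 = 1. *)
  transitivity (e * (b ^+ 2 + g ^+ 2) / 2 * (cos t ^+ 2 + sin t ^+ 2 - 1)).
    by field.
  by rewrite cos2Dsin2 subrr mulr0.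
have cF : continuous F.
  by move=> t; apply/differentiable_continuous/derivable1_diffP; case: (dF t).
pose f (t : R) : R := c - e * (q - (b * cos t + g * sin t)) ^+ 2.
have cf : continuous f.
  move=> t; apply/differentiable_continuous/derivable1_diffP.
  by rewrite /f; exact: ex_derive.
rewrite (@continuous_FTC2 _ _ F).
- rewrite -EFinB /F sin0 cos0; congr EFin.
  have -> : sin (2 * pi) = 0 :> R by rewrite mulr_natl sin2pi.
  have -> : cos (2 * pi) = 1 :> R by rewrite mulr_natl cos2pi.
  by field.
- by rewrite mulr_gt0// pi_gt0.
- apply: continuous_subspaceT => t.
  exact: cf.
- split; first by move=> t _; case: (dF t).
  + exact/cvg_at_right_filter/cF.
  + exact/cvg_at_left_filter/cF.
- by move=> t _; rewrite derive1E; case: (dF t).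
Qed.

(** * Real coordinates on the complex line *)

Definition cx {R : realType} (p : R * R) : Cx R := (p.1 +i* p.2)%C.
Definition sqn {R : realType} (p : R * R) : R := p.1 ^+ 2 + p.2 ^+ 2.

Lemma circle_point_cx (R : realType) (p : R * R) (r t : R) :
  circle_point (cx p) r t = cx (p.1 + r * cos t, p.2 + r * sin t).
Proof. by []. Qed.

Lemma real_complex_continuous (R : realType) : continuous (fun x : R => x%:C%C : Cx R).
Proof.
(* The radius is an element [e +i* f] of [Cx R]; its positivity means [f = 0] and [0 < e]. *)
move=> x; apply/cvgrPdist_lt => -[e f]; rewrite ltcE /= => /andP[/eqP -> e0].
near=> t; rewrite -rmorphB /= normc_def /= ltcE /= eqxx expr0n addr0 sqrtr_sqr.
by near: t; exact: cvgr_dist_lt.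
Unshelve. all: by end_near. Qed.

Lemma cx_continuous (R : realType) : continuous (cx : R * R -> Cx R).
Proof.
move=> p.
have -> : cx = (fun q : R * R => (q.1)%:C%C + 'i%C * (q.2)%:C%C : Cx R).
  by apply/funext => -[x y]; rewrite /cx /=; simpc.
apply: cvgD; last apply: cvgMr.
  by apply: (continuous_comp (@cvg_fst _ _ _ _ _)); exact: real_complex_continuous.
by apply: (continuous_comp (@cvg_snd _ _ _ _ _)); exact: real_complex_continuous.
Qed.

Lemma sqn_continuous (R : realType) : continuous (sqn : R * R -> R).
Proof.
move=> p; apply: cvgD; apply: cvgM; (exact: cvg_fst || exact: cvg_snd).
Qed.

Lemma sqn_ball_compact (R : realType) (c : R) : compact [set p : R * R | sqn p <= c].
Proof.
have [c0|c0] := ltP c 0.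
  rewrite (_ : [set _ | _] = set0); first exact: compact0.
  by rewrite -subset0 => p /=; rewrite leNgt (lt_le_trans c0)// addr_ge0// sqr_ge0.
apply: (@subclosed_compact _ _ (`[- (c + 1), c + 1] `*` `[- (c + 1), c + 1])).
- rewrite (_ : [set _ | _] = sqn @^-1` [set y | y <= c])//.
  by apply: preimage_closed; [move=> p _; exact: sqn_continuous|exact: closed_le].
- by apply: compact_setX; exact: segment_compact.
- move=> [x y]; rewrite /sqn /= => h; rewrite !in_itv/=.
  have hx := sqr_ge0 x; have hy := sqr_ge0 y.
  split; apply/andP; split; nra.
Qed.

(** * Barrier, maximum principle and Hopf's lemma on the unit disc *)

(** On the circle, [sqn] equals sqn p + r^2 + 2 r (p.1 cos t + p.2 sin t), so the bound is the
    integrand of [integral_circle] with b = 2 r p.1 and g = 2 r p.2. *)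
Lemma submean_barrier (R : realType) (D : set (Cx R)) (u : Cx R -> \bar R)
    (p : R * R) (r M e : R) :
  subharmonic D u -> 0 < r ->
  (forall w : Cx R, Normc.normc (w - cx p) <= r -> D w) ->
  (forall t, (u (circle_point (cx p) r t) <=
    (M - e * (3 / 2 - sqn (p.1 + r * cos t, p.2 + r * sin t)) ^+ 2)%:E)%E) ->
  (u (cx p) <= (M - e * ((3 / 2 - sqn p - r ^+ 2) ^+ 2 + 2 * r ^+ 2 * sqn p))%:E)%E.
Proof.
move=> [_ _ sub] r0 discD uM; apply: le_trans (sub _ _ r0 discD) _.
have pi20 : 0 < 2 * pi :> R by rewrite mulr_gt0// pi_gt0.
rewrite -lee_pdivlMl ?invr_gt0// invrK.
apply: (@le_trans _ _ (\int[lebesgue_measure]_(t in `[0%R, (2 * pi)%R]%classic)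
   (M - e * ((3 / 2 - sqn p - r ^+ 2) -
      ((2 * r * p.1) * cos t + (2 * r * p.2) * sin t)) ^+ 2)%:E)%E).
  apply: le_integral_nonmeasurable => t _; apply: le_trans (uM t) _.
  rewrite lee_fin le_eqVlt; apply/orP; left; apply/eqP.
  congr (M - e * _ ^+ 2); rewrite /sqn /=.
  rewrite [r ^+ 2 in RHS](_ : _ = r ^+ 2 * (cos t ^+ 2 + sin t ^+ 2)); first by ring.
  by rewrite cos2Dsin2 mulr1.
rewrite integral_circle -EFinM lee_fin le_eqVlt; apply/orP; left; apply/eqP.
by congr (_ * (M - e * (_ + _))); rewrite /sqn; field.
Qed.

(** At a negative minimum of -u - h, the inner circle is excluded by h <= e <= -u, the outer one by
    h = 0 < -u, and the interior by strict subharmonicity of h. Taking [s < 1] keeps the closed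
    annulus inside [D]. *)
Lemma barrier_le (R : realType) (D : set (Cx R)) (u : Cx R -> \bar R) (e s : R) :
  subharmonic D u -> (forall z, D z -> (u z < 0)%E) ->
  (forall p, sqn p < 1 -> D (cx p)) ->
  0 < e -> 4 / 5 < s < 1 ->
  (forall p, sqn p <= 4 / 5 -> (e%:E <= - u (cx p))%E) ->
  forall p, 4 / 5 <= sqn p <= s ->
    ((e * ((3 / 2 - sqn p) ^+ 2 - (3 / 2 - s) ^+ 2))%:E <= - u (cx p))%E.
Proof.
move=> sub uneg discD e0 /andP[s45 s1] uin.
pose h (p : R * R) : R := e * ((3 / 2 - sqn p) ^+ 2 - (3 / 2 - s) ^+ 2).
have ch : continuous h.
  move=> q; apply: cvgMr; apply: cvgB; last exact: cvg_cst.
  by apply: cvgM; (apply: cvgB; [exact: cvg_cst|exact: sqn_continuous]).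
pose K := [set p : R * R | 4 / 5 <= sqn p <= s].
have KD p : K p -> D (cx p) by move=> /andP[_ ps]; apply: discD; lra.
have cK : compact K.
  apply: (@subclosed_compact _ _ [set p | sqn p <= 1]).
  - rewrite (_ : K = sqn @^-1` [set` `[4 / 5, s]]).
      apply: preimage_closed => [p _|]; first exact: sqn_continuous.
      exact: interval_closed.
    by apply/seteqP; split => p; rewrite /K /= in_itv.
  - exact: sqn_ball_compact.
  - by move=> p /andP[_ ps] /=; lra.
pose G p := (- u (cx p) - (h p)%:E)%E.
suff GK p : K p -> (0 <= G p)%E.
  by move=> p /GK; rewrite /G sube_ge0.
have lscG x (a : R) : K x -> (a%:E < G x)%E ->
    \forall y \near x, K y -> (a%:E < G y)%E.
  move=> Kx aG.
  (* A real level [w] separates the two terms and also covers -u = +oo: near [x], -u stays above [w]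
     and h below w - a. *)
  have [w [aw wu]] : exists w, a + h x < w /\ (w%:E < - u (cx x))%E.
    move: aG; rewrite /G; case: (- u (cx x))%E => [v||] //=.
      rewrite -EFinB !lte_fin => av; exists ((a + h x + v) / 2).
      by split; rewrite ?lte_fin; lra.
    by move=> _; exists (a + h x + 1); rewrite ltry; split => //; lra.
  have [V nV VP] := (let: And3 H _ _ := sub in H) _ _ wu.
  have {}nV : \forall y \near x, D (cx y) -> V (cx y).
    have : within D (nbhs (cx x)) V by rewrite nbhs_subspace_in//; exact: KD.
    exact: cx_continuous.
  have nh : \forall y \near x, h y < w - a.
    have hx : h x < w - a by lra.
    exact: (ch x _ (lt_nbhsl hx)).
  near=> y => Ky.
  have Vy : V (cx y) by move: (KD _ Ky); near: y.
  have hy : h y < w - a by near: y.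
  by rewrite /G lteBrDr// -EFinD; apply: le_lt_trans (VP _ Vy); rewrite lee_fin; lra.
move=> Kp.
have [p0 Kp0 min0] := lsc_compact_min _ _ K G cK (ex_intro _ p Kp) lscG.
apply: le_trans (min0 _ Kp); rewrite leNgt; apply/negP => G0.
have {}G0 : (- u (cx p0) < (h p0)%:E)%E by rewrite -sube_lt0// orbT.
move: Kp0 => /[dup] Kp0 /andP[s45p sps].
have up0 : (0 < - u (cx p0))%E by rewrite oppe_gt0; apply: uneg; exact: KD.
have [v uv] : exists v, u (cx p0) = (- v)%:E.
  by move: G0 up0; case: (u (cx p0)) => [r||] // _ _; exists (- r); rewrite opprK.
have {}s45p : 4 / 5 < sqn p0.
  rewrite lt_neqAle s45p andbT; apply/eqP => p45.
  have := uin p0; rewrite -p45 lexx => /(_ isT); rewrite leNgt => /negP; apply.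
  apply: lt_le_trans G0 _; rewrite lee_fin /h -p45.
  have := sqr_ge0 (3 / 2 - s); nra.
have {}sps : sqn p0 < s.
  rewrite lt_neqAle sps andbT; apply/eqP => p45.
  by move: (lt_trans up0 G0); rewrite lte_fin /h p45 subrr mulr0 ltxx.
(* A circle of radius r around p0 stays in the annulus, where the sub-mean value
   inequality contradicts the strict subharmonicity of the barrier. *)
pose r := Num.min (1 / 2) (Num.min ((sqn p0 - 4 / 5) / 5) ((s - sqn p0) / 5)).
have r0 : 0 < r by rewrite !lt_min; apply/and3P; split; lra.
have [r1 r2 r3] : [/\ r <= 1 / 2, r <= (sqn p0 - 4 / 5) / 5 & r <= (s - sqn p0) / 5].
  by rewrite /r !ge_min !lexx !orbT.
(* By Cauchy-Schwarz and sqn p0 < 1, [sqn] varies by at most 2 r + r^2 <= 5 r / 2 on the disc, which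
   is at most half of either gap. *)
have discK (q : R * R) : (q.1 - p0.1) ^+ 2 + (q.2 - p0.2) ^+ 2 <= r ^+ 2 -> K q.
  case: q => x y /= hq; rewrite /K /=.
  have sq : sqn (x, y) = sqn p0 + 2 * (p0.1 * (x - p0.1) + p0.2 * (y - p0.2)) +
      ((x - p0.1) ^+ 2 + (y - p0.2) ^+ 2) by rewrite /sqn /=; ring.
  have : (p0.1 * (x - p0.1) + p0.2 * (y - p0.2)) ^+ 2 <= r ^+ 2.
    apply: (@le_trans _ _ (sqn p0 * ((x - p0.1) ^+ 2 + (y - p0.2) ^+ 2))).
      rewrite -subr_ge0 /sqn.
      rewrite (_ : _ - _ = (p0.1 * (y - p0.2) - p0.2 * (x - p0.1)) ^+ 2); last by ring.
      exact: sqr_ge0.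
    rewrite -[leRHS]mul1r; apply: ler_pM => //; [lra| |lra].
    by rewrite addr_ge0// sqr_ge0.
  rewrite -ler_sqrt ?sqr_ge0// !sqrtr_sqr ler_norml gtr0_norm// => /andP[X1 X2].
  have : r ^+ 2 <= r / 2 by rewrite expr2 ler_pM2l//; lra.
  have : 0 <= (x - p0.1) ^+ 2 + (y - p0.2) ^+ 2 by rewrite addr_ge0// sqr_ge0.
  by rewrite sq; move=> *; apply/andP; split; lra.
(* Minimality at [p0] reads u <= -v + h(p0) - h on [K]; the terms in [s] cancel, which leaves this
   constant. *)
have := submean_barrier R D u p0 r (- v + e * (3 / 2 - sqn p0) ^+ 2) e sub r0.
rewrite uv lee_fin => H.
suff : - v <= - v + e * (3 / 2 - sqn p0) ^+ 2 -
     e * ((3 / 2 - sqn p0 - r ^+ 2) ^+ 2 + 2 * r ^+ 2 * sqn p0).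
  have r20 : 0 < r ^+ 2 by rewrite exprn_gt0.
  (* The last factor is positive because sqn p0 > 4/5 > 3/4. *)
  rewrite -subr_ge0 (_ : _ - _ = - e * r ^+ 2 * (4 * sqn p0 - 3 + r ^+ 2)); last by field.
  have : 0 < e * r ^+ 2 by rewrite mulr_gt0.
  nra.
apply: H => [[x y]|t].
  rewrite /= -[r in _ <= r]gtr0_norm// -sqrtr_sqr ler_sqrt ?sqr_ge0// => xyr.
  by apply: (KD (x, y)); exact: discK.
have Kc : K (p0.1 + r * cos t, p0.2 + r * sin t).
  by apply: discK; rewrite /= ![_ + _ - _]addrAC !subrr !add0r !exprMn -mulrDr cos2Dsin2 mulr1.
have := min0 _ Kc; rewrite /G uv circle_point_cx.
set c := cx _; rewrite -EFinN opprK -EFinB leeBrDr// -EFinD leeNr -EFinN.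
move=> /le_trans; apply; rewrite lee_fin /h; lra.
Unshelve. all: by end_near. Qed.
(** Semicontinuity bounds -u below by some e > 0 on the inner disc, and [barrier_le] carries this
    bound towards the unit circle. The threshold 9/10 ensures x^2 > 4/5. *)
Lemma hopf_disc (R : realType) (D : set (Cx R)) (u : Cx R -> \bar R) :
  subharmonic D u -> (forall z, D z -> (u z < 0)%E) ->
  (forall p, sqn p < 1 -> D (cx p)) ->
  exists2 c : R, 0 < c &
    forall x, 9 / 10 <= x < 1 -> ((c * (1 - x))%:E <= - u (cx (x, 0%R)))%E.
Proof.
move=> sub uneg discD.
have [e e0 uin] : exists2 e : R, 0 < e &
    forall p, sqn p <= 4 / 5 -> (e%:E <= - u (cx p))%E.
  have D45 p : sqn p <= 4 / 5 -> D (cx p) by move=> ?; apply: discD; lra.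
  have [||p0 Kp0 min0] := lsc_compact_min _ _ _ (fun p => - u (cx p))%E
      (sqn_ball_compact R (4 / 5)).
  - by exists (0, 0); rewrite /= /sqn /=; lra.
  - move=> x a /D45 Dx au; have [V nV VP] := (let: And3 H _ _ := sub in H) _ _ au.
    have {}nV : \forall y \near x, D (cx y) -> V (cx y).
      have : within D (nbhs (cx x)) V by rewrite nbhs_subspace_in.
      exact: cx_continuous.
    by apply: filterS nV => y Vy /D45 /Vy; exact: VP.
  have : (0 < - u (cx p0))%E by rewrite oppe_gt0; exact/uneg/D45.
  case u0 : (- u (cx p0))%E => [v||] //; last first.
    (* Here [u] is identically -oo on the inner disc, so any positive constant works. *)
    by exists 1 => // p /min0; rewrite u0 leye_eq => /eqP ->; exact: leey.
  by rewrite lte_fin => v0; exists v => // p /min0; rewrite u0.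
exists (e / 2) => [|x /andP[x9 x1]]; first by lra.
have x2 : x ^+ 2 < 1 by nra.
have xs : sqn (x, 0) = x ^+ 2 by rewrite /sqn /=; ring.
(* With [s] midway between x^2 and 1, the barrier is e (s - x^2) (3 - x^2 - s), where s - x^2 = (1 -
   x) (1 + x) / 2 and the last factor exceeds 1. *)
have := barrier_le R D u e ((1 + x ^+ 2) / 2) sub uneg discD e0 _ uin (x, 0).
rewrite xs => /(_ _ _) H; apply: le_trans (H _ _); last 2 first.
- by apply/andP; split; nra.
- by apply/andP; split; nra.
rewrite lee_fin -mulrA ler_pM2l//.
nra.
Qed.

(** * A disc in the domain touching its complement *)

Lemma cxM (R : realType) (p q : R * R) :
  exists2 s, (cx p * cx q : Cx R) = cx s & sqn s = sqn p * sqn q.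
Proof.
exists (p.1 * q.1 - p.2 * q.2, p.1 * q.2 + p.2 * q.1); first by [].
by rewrite /sqn /=; ring.
Qed.

Lemma touching_disc (R : realType) (n : nat) (Omega : set 'rV[Cx R]_n)
    (z0 : 'rV[Cx R]_n) :
  (0 < n)%N -> open Omega -> bounded_set Omega -> Omega z0 ->
  exists b : 'rV[Cx R]_n, (forall p, sqn p < 1 -> Omega (z0 + cx p *: b)) /\
    ~ Omega (z0 + b).
Proof.
case: n Omega z0 => // n Omega z0 _ oO [M [Mr HM]] Oz0.
(* Any nonzero direction would do. *)
pose b0 : 'rV[Cx R]_n.+1 := const_mx 1.
have b0_neq0 : b0 != 0.
  by apply/eqP => /matrixP /(_ ord0 ord0); rewrite !mxE => /eqP; rewrite oner_eq0.
pose f (p : R * R) := z0 + cx p *: b0.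
have cf : continuous f.
  move=> p; apply: cvgD; first exact: cvg_cst.
  by apply: cvgZr_tmp; exact: cx_continuous.
have [p1 np1] : exists p1, ~ Omega (f p1).
  (* This gives [zeta *: b0] a norm above M + 1 + |z0|, the most that a point of [Omega] on the line
     allows. *)
  pose zeta : Cx R := (M + 1 + `|z0| + 1) / `|b0|.
  exists (complex.Re zeta, complex.Im zeta); rewrite /f (_ : cx _ = zeta); last first.
    by case: (zeta).
  move=> /(HM (M + 1)); rewrite /= => /(_ _) H.
  have {}H : `|z0 + zeta *: b0| <= M + 1 by apply: H; rewrite ltrDl.
  have : `|zeta *: b0| <= M + 1 + `|z0|.
    rewrite -[X in `|X|](addKr z0) addrC; apply: le_trans (ler_normB _ _) _.
    by rewrite lerD2r.
  rewrite normrZ /zeta normf_div normr_id divfK ?normr_eq0//.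
  move=> /(lt_le_trans _) lt_le; suff /lt_le : M + 1 + `|z0| < `|M + 1 + `|z0| + 1| by rewrite ltxx.
  apply: (@lt_le_trans _ _ (M + 1 + `|z0| + 1)); first by rewrite ltrDl.
  by apply: real_ler_norm; rewrite !realD ?normr_real ?real1.
(* Cutting at the known exterior point [p1] gives compactness without changing the minimum of [sqn]
   over the complement. *)
pose K := [set p | ~ Omega (f p)] `&` [set p | sqn p <= sqn p1].
have cK : compact K.
  apply: subclosed_compact (sqn_ball_compact R (sqn p1)) _; last by move=> p [].
  apply: closedI.
    apply: (@preimage_closed _ _ f (~` Omega)) => [p _|]; first exact: cf.
    exact: open_closedC.
  apply: (@preimage_closed _ _ sqn [set y | y <= sqn p1]) => [p _|].
    exact: sqn_continuous.
  exact: closed_le.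
have [||q /set_mem[nq qp1] qmin] := @compact_EVT_min _ _ sqn K _ cK.
- by exists p1; split => /=.
- by apply: continuous_subspaceT => p; exact: sqn_continuous.
have inO p : sqn p < sqn q -> Omega (f p).
  move=> pq; apply: contrapT => np; have /qmin : p \in K.
    by apply/mem_set; split => //=; apply: le_trans (ltW pq) _.
  by rewrite leNgt pq.
have q0 : 0 < sqn q.
  rewrite lt_neqAle addr_ge0 ?sqr_ge0// andbT; apply/eqP => q0.
  apply: nq; rewrite /f.
  have /andP[/eqP q1 /eqP q2] : (q.1 == 0) && (q.2 == 0).
    by move/esym/eqP: q0; rewrite /sqn paddr_eq0 ?sqr_ge0// !sqrf_eq0.
  by rewrite /cx q1 q2 scale0r addr0.
exists (cx q *: b0); split => // p p1'.
have [s ps sqs] := cxM R p q; rewrite scalerA ps; apply: inO.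
by rewrite sqs gtr_pMl.
Qed.

Lemma enorm_real_scale (R : realType) (n : nat) (y : R) (b : 'rV[Cx R]_n) :
  enorm (cx (y, 0) *: b) = `|y| * enorm b.
Proof.
rewrite /enorm -sqrtr_sqr -sqrtrM ?sqr_ge0// mulr_sumr; congr Num.sqrt.
by apply: eq_bigr => j _; rewrite mxE; case: (b ord0 j) => r i /=; ring.
Qed.

(** * Contradiction along a radius of the touching disc *)

Theorem theorem1p5 (R : realType) (n : nat) (Omega : set 'rV[Cx R]_n)
    (n_gt0 : (0 < n)%N)
    (Omega_dom : domain Omega)
    (Omega_bnd : bounded_set Omega)
    (Omega_pc : pseudoconvex Omega)
    (eps : R) (eps_gt0 : 0 < eps)
    (k : nat) (k_gt0 : (0 < k)%N) :
  ~ exists (rho : 'rV[Cx R]_n -> \bar R) (C : R),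
      [/\ neg_psh Omega rho,
          0 < C
        & exists U : set 'rV[Cx R]_n,
            [/\ open U,
                boundary Omega `<=` U
              & forall z, Omega z -> U z ->
                  iterlog_pos k (bdist Omega z) /\
                  (- rho z <= (C * bdist Omega z *
                               iterlog k (bdist Omega z) `^ (- eps))%:E)%E]].
Proof.
move=> [rho [C [[[_ _ psh_rho] rho_neg] C0 [U [oU bU near_bd]]]]].
have [oO _ [z0 Oz0]] := Omega_dom.
have [b [discO nOb]] := touching_disc _ _ _ _ n_gt0 oO Omega_bnd Oz0.
have [c c0 hopf] := hopf_disc _ _ _ (psh_rho z0 b) (fun _ => rho_neg _) discO.
pose f (x : R) := z0 + cx (x, 0) *: b.
have f1 : f 1 = z0 + b by rewrite /f (_ : cx _ = 1)// scale1r.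
have cf : continuous f.
  move=> x; apply: cvgD; first exact: cvg_cst.
  by apply: cvgZr_tmp; exact: real_complex_continuous.
have fO x : 9 / 10 <= x < 1 -> Omega (f x).
  by move=> /andP[x9 x1]; apply: discO; rewrite /sqn /=; nra.
have near1 : \forall x \near (1 : R)^'-, 9 / 10 <= x < 1.
  near=> x; apply/andP; split; near: x.
    by apply: nbhs_left_ge; lra.
  exact: nbhs_left_lt.
have bd : boundary Omega (f 1).
  rewrite /boundary; split; last by rewrite f1 => /interior_subset.
  move=> V nV.
  have nfV : \forall x \near (1 : R)^'-, V (f x).
    exact: (cvg_at_left_filter (cf 1)).
  have [x [xV x1]] : exists x, V (f x) /\ 9 / 10 <= x < 1.
    by apply: (@filter_ex _ (1 : R)^'-); near=> x; split; near: x.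
  by exists (f x); split => //; exact: fO.
have fU : \forall x \near (1 : R)^'-, U (f x).
  by apply: (cvg_at_left_filter (cf 1)); apply: open_nbhs_nbhs; split => //; exact: bU.
(* L_k > M makes L_k^eps exceed C |b| / c, so that C (1 - x) |b| L_k^(-eps) < c (1 - x). *)
pose M := (C * enorm b / c + 1) `^ eps^-1.
have [eta eta0 Leta] := iterlog_gt R k M k_gt0.
have nb0 : 0 <= enorm b by exact: sqrtr_ge0.
(* The [+ 1] keeps the denominator positive. *)
have small : \forall x \near (1 : R)^'-, 1 - eta / (enorm b + 1) < x.
  by apply: nbhs_left_gt; rewrite ltrBlDr ltrDl divr_gt0// ltr_wpDl.
have [x [[/andP[x9 x1] Ux] xs]] : exists x, (9 / 10 <= x < 1 /\ U (f x)) /\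
    1 - eta / (enorm b + 1) < x.
  by apply: (@filter_ex _ (1 : R)^'-); near=> x; split; [split|]; near: x.
have x91 : 9 / 10 <= x < 1 by rewrite x9.
have [Lpos] := near_bd _ (fO _ x91) Ux.
have dist_le : bdist Omega (f x) <= (1 - x) * enorm b.
  apply: ge_inf; first by exists 0 => _ [w _ <-]; exact: sqrtr_ge0.
  exists (f 1) => //.
  rewrite (_ : f x - f 1 = cx (x - 1, 0) *: b); last first.
    by rewrite /f opprD addrACA subrr add0r -scalerBl /cx/=; congr (_ *: b); simpc.
  by rewrite enorm_real_scale distrC ger0_norm// subr_ge0 ltW.
(* [ln] vanishes on nonpositive reals, so positivity of L_1 in [iterlog_pos] already forces a
   positive distance. *)
have dist_gt0 : 0 < bdist Omega (f x).
  have := Lpos 1 _; rewrite k_gt0 => /(_ isT).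
  by apply: contraTT; rewrite -!leNgt /iterlog /= => ?; rewrite ln0// normr0.
have /(Leta _) LM : 0 < bdist Omega (f x) < eta.
  rewrite dist_gt0 (le_lt_trans dist_le)//.
  apply: (@le_lt_trans _ _ ((1 - x) * (enorm b + 1))).
    by rewrite ler_wpM2l; lra.
  by rewrite -ltr_pdivlMr; lra.
apply/negP; rewrite -ltNge; apply: lt_le_trans (hopf _ x91).
rewrite lte_fin.
set L := iterlog k _ in LM *; set d := bdist _ _ in dist_le dist_gt0 *.
have M0 : 0 < M by rewrite powR_gt0// ltr_wpDl// divr_ge0 ?mulr_ge0// ltW.
have : C * enorm b / c + 1 < L `^ eps.
  have <- : M `^ eps = C * enorm b / c + 1.
    by rewrite /M -powRrM mulVf ?gt_eqF// powRr1// addr_ge0// divr_ge0 ?mulr_ge0// ltW.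
  by rewrite gt0_ltr_powR// nnegrE ltW// (lt_trans M0).
rewrite powRN; move: (L `^ eps) => A hA.
have A0 : 0 < A.
  by apply: le_lt_trans hA; rewrite addr_ge0// divr_ge0 ?mulr_ge0// ltW.
rewrite ltr_pdivrMr//.
have : C * enorm b < c * A.
  by rewrite [ltRHS]mulrC -ltr_pdivrMr//; lra.
have : C * d <= C * ((1 - x) * enorm b) by rewrite ler_pM2l.
nra.
Unshelve. all: by end_near. Qed.
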